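(* For every non-negative integer $l$, the rational number $\epsilon_l$ satisfies $$v_2(\epsilon_l)=-l.$$
   Context: The sequence of rational numbers $\{\epsilon_i\}_{i=0}^\infty$ is defined by $\epsilon_0=1$ and, inductively for each integer $l\ge 1$, by $$\frac{1}{(2l+1)!}=\sum_{i=1}^l\ \sum_{\substack{j_1+\cdots+j_i=l\\ j_1,\dots,j_i\ge 1}}\frac{2^i\epsilon_i}{(2j_1)!\cdots(2j_i)!}.$$ Equivalently, it is the unique sequence satisfying $$\sum_{l=0}^\infty\frac{x^l}{(2l+1)!}=\sum_{i=0}^\infty\epsilon_i\left(\sum_{j=1}^\infty\frac{2x^j}{(2j)!}\right)^i$$ in the ring of formal power series $\mathbb{Q}[[x]]$. For a prime $p$ and a rational number $q$, $v_p(q)$ denotes the $p$-adic valuation of $q$: if $q=p^at/(p^bs)$ with $s,t$ integers prime to $p$, then $v_p(q)=a-b$. *)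

(* Defs.v *)
From HB Require Import structures.
From mathcomp Require Import all_boot all_order all_algebra.

Set Implicit Arguments.
Unset Strict Implicit.
Unset Printing Implicit Defensive.

Import Order.TTheory GRing.Theory Num.Theory.
Local Open Scope ring_scope.

(* The inner sum ranges over the compositions of l into i positive parts;
   every part is at most l, so the tuples are functions into 'I_l.+1. *)
Definition epsilon_term (eps : nat -> rat) (l i : nat) : rat :=
  \sum_(j : {ffun 'I_i -> 'I_l.+1} |
          (\sum_(k < i) j k == l)%N && [forall k, (1 <= j k)%N])
    (2 ^+ i * eps i / \prod_(k < i) ((2 * j k)`!)%N%:R).

Definition is_epsilon (eps : nat -> rat) : Prop :=
  eps 0%N = 1 /\
  forall l : nat, (1 <= l)%N ->
    ((2 * l + 1)`!)%N%:R^-1 = \sum_(1 <= i < l.+1) epsilon_term eps l i.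

(* At q = 0, where the valuation is +oo, this takes the value 0. *)
Definition padic_val (p : nat) (q : rat) : int :=
  (logn p `|numq q|)%:Z - (logn p `|denq q|)%:Z.

Lemma padic_valE (p : nat) (a b : nat) (s t : int) :
  prime p -> coprimez s p%:Z -> coprimez t p%:Z ->
  padic_val p ((p%:R ^+ a * t%:~R) / (p%:R ^+ b * s%:~R)) = a%:Z - b%:Z.
Proof.
move=> pp cs ct; set q := _ / _.
have p0 : p%:R != 0 :> rat by rewrite pnatr_eq0 -lt0n prime_gt0.
have nz (x : int) : coprimez x p%:Z -> x != 0.
  apply: contraTneq => ->; rewrite /coprimez /gcdz /= gcd0n.
  by apply/negP => /eqP [] p1; rewrite p1 in pp.
have lg (x : int) : coprimez x p%:Z -> logn p `|x| = 0%N.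
  by move=> cx; rewrite logn_coprime // coprime_sym.
have s0 := nz _ cs; have t0 := nz _ ct.
have q0 : q != 0 by rewrite mulf_neq0 ?invr_eq0 ?mulf_neq0 ?expf_neq0 ?intr_eq0.
have E : numq q * (p%:Z ^+ b * s) = denq q * (p%:Z ^+ a * t).
  apply/eqP; rewrite -(eqr_int rat) !rmorphM !rmorphXn /= -pmulrn.
  have : q = (numq q)%:~R / (denq q)%:~R by rewrite divq_num_den.
  move/eqP; rewrite eqr_div ?mulf_neq0 ?expf_neq0 ?intr_eq0 ?denq_eq0 //.
  by move/eqP <-; rewrite mulrC.
have {E} := congr1 (fun z => logn p (absz z)) E.
rewrite !abszM !abszX /= !lognM ?muln_gt0 ?expn_gt0 ?absz_gt0 ?prime_gt0 ?numq_eq0 ?denq_eq0 //.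
rewrite !lognX (logn_prime p pp) eqxx (lg _ cs) (lg _ ct) !addn0 !muln1 => E.
rewrite /padic_val; apply/eqP; rewrite subr_eq addrAC eq_sym subr_eq.
by rewrite -!PoszD E addnC.
Qed.

Lemma epsilon_term_ext (e f : nat -> rat) (l i : nat) :
  e i = f i -> epsilon_term e l i = epsilon_term f l i.
Proof. by rewrite /epsilon_term => ->. Qed.

Lemma epsilon_term_diag (e : nat -> rat) (l : nat) : epsilon_term e l l = e l.
Proof.
rewrite /epsilon_term; case: l => [|l].
  rewrite (big_pred1 [ffun=> ord0]) ?big_ord0 ?expr0 ?mul1r ?divr1 //.
  move=> j /=; rewrite big_ord0 eqxx /=.
  have -> : j == [ffun=> ord0] by apply/eqP/ffunP => -[].
  by apply/forallP => -[].
pose o : 'I_l.+2 := inord 1.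
have oE : o = 1%N :> nat by rewrite inordK.
rewrite (big_pred1 [ffun=> o]) => [|j /=].
  under eq_bigr do rewrite ffunE oE.
  by rewrite prodr_const card_ord mulrAC divff ?mul1r // expf_neq0.
apply/andP/eqP => [[/eqP sj /forallP pj]|->]; last first.
  split; last by apply/forallP => k; rewrite ffunE oE.
  by under eq_bigr do rewrite ffunE oE; rewrite sum1_card card_ord.
have : (\sum_(k < l.+1) (j k - 1) = 0)%N.
  by rewrite sumnB // sj sum1_card card_ord subnn.
move/eqP; rewrite sum_nat_eq0 => /forallP z.
apply/ffunP => k; apply/val_inj; rewrite ffunE /= oE.
by apply/eqP; rewrite eqn_leq pj andbT -subn_eq0 (implyP (z k)).
Qed.

Lemma epsilon_rec (e : nat -> rat) (l : nat) :
  \sum_(1 <= i < l.+2) epsilon_term e l.+1 i =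
  \sum_(1 <= i < l.+1) epsilon_term e l.+1 i + e l.+1.
Proof. by rewrite big_nat_recr //= epsilon_term_diag. Qed.

Lemma is_epsilon_unique (e f : nat -> rat) :
  is_epsilon e -> is_epsilon f -> e =1 f.
Proof.
move=> [e0 eS] [f0 fS]; elim/ltn_ind => -[|l] IH; first by rewrite e0 f0.
have := eS l.+1 isT; rewrite (fS l.+1 isT) !epsilon_rec.
rewrite (@eq_big_nat _ _ _ _ _ (epsilon_term e l.+1)
          (epsilon_term f l.+1)) => [|i /andP[_ il]].
  by move/addrI->.
exact/epsilon_term_ext/IH.
Qed.

Lemma is_epsilon_exists : exists eps : nat -> rat, is_epsilon eps.
Proof.
pose next (s : seq rat) : rat := let l := size s in
  if l is 0%N then 1 else
  ((2 * l + 1)`!)%N%:R^-1 - \sum_(1 <= i < l) epsilon_term (nth 0 s) l i.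
pose S n := iter n (fun s => rcons s (next s)) [::].
have sS n : size (S n) = n by elim: n => //= n IH; rewrite size_rcons IH.
pose eps n := next (S n).
have nS n i : (i < n)%N -> nth 0 (S n) i = eps i.
  elim: n => // n IH; rewrite ltnS leq_eqVlt /= nth_rcons sS.
  by case/predU1P => [->|lin]; rewrite ?ltnn ?eqxx // lin IH.
exists eps; split=> // -[//|l] _; rewrite epsilon_rec.
rewrite [eps l.+1]/eps /next sS addrC.
rewrite (@eq_big_nat _ _ _ _ _ _ (epsilon_term eps l.+1)) ?subrK //.
by move=> i /andP[_ il]; apply/epsilon_term_ext/nS.
Qed.

(* Main.v *)
Require Import Defs.
From mathcomp Require Import all_boot all_order all_algebra.
From mathcomp Require Import ring zify.
Import Order.TTheory GRing.Theory Num.Theory.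
Local Open Scope ring_scope.

(** Put x = y^2, w = cosh y - 1 and S = sinh y / y, all power series in x.
The sum of the 2x^j/(2j)! over positive j is 2w, so the definition of the
eps_i reads S = G(w) with G(w) = sum_i 2^i eps_i w^i, and the claim is that
every coefficient of G is a 2-adic unit.

The point is that 1/G has an explicit hypergeometric expansion. Since
w = 2 sinh^2(y/2), the series 1/S = y / sinh y, written in terms of w, is the
classical series H(w) = sum_n h_n w^n with

  h_n = (-1)^n n! / (1 * 3 * 5 * ... * (2n+1)),

that is, arcsinh z / (z sqrt(1 + z^2)) at z = sinh(y/2). The ratio
h_(n+1) / h_n = -(n+1)/(2n+3) is a 2-adic integer, odd for n = 0 and even for
n = 1; hence h_0 and h_1 are odd and all later h_n are even, so that
H = 1 + w modulo 2. As G H = 1, it follows that G = 1/(1 + w) modulo 2, and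
all coefficients of G are odd.

The identity S H(w) = 1 ([sinhc_hpoly]) is proved by differential equations.
The recurrence for h_n says that w (2 + w) H' + (1 + w) H = 1. Substituting
w = cosh y - 1, for which dw/dx = S/2, w (2 + w) = x S^2 and
1 + w = S + 2x dS/dx, gives 2x (S H(w))' + S H(w) = 1, and comparing
coefficients leaves only S H(w) = 1. Hence (G H)(w) = 1, and since
w = x/2 + ... has a compositional inverse, G H = 1 ([dvdXn_comp],
[epsilon_hcoef_convolution]); induction on l then gives the residues
([residue2_epsilon]).

Power series are represented by polynomials truncated at degree N, and an
identity of power series by divisibility by 'X^N of the difference. *)

(** * Polynomials modulo a power of the variable *)

Lemma dvdXnP (F : fieldType) (N : nat) (p : {poly F}) :
  reflect (forall i, (i < N)%N -> p`_i = 0) ('X^N %| p).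
Proof.
apply: (iffP idP) => [/dvdpP[q ->] i iN|p0]; first by rewrite coefMXn iN.
rewrite -(poly_take_drop N p) (_ : take_poly N p = 0) ?add0r ?dvdp_mulIr //.
by apply/polyP => i; rewrite coef_take_poly coef0; case: ifP => // /p0.
Qed.

(** Substituting a series of order exactly one does not change the order of
vanishing at 0: composing with 'X * u pulls a factor 'X * u out of each factor
'X of p, and u is prime to 'X. *)
Lemma dvdXn_comp (F : fieldType) (N : nat) (p u : {poly F}) :
  u`_0 != 0 -> 'X^N %| p \Po ('X * u) -> 'X^N %| p.
Proof.
move=> u0; elim: N p => [|N IH] p; first by rewrite expr0 !dvd1p.
move=> dv.
have p0 : p`_0 = 0.
  have := dvdXnP _ _ _ dv 0%N isT.
  by rewrite -!horner_coef0 horner_comp hornerM hornerX mul0r.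
have pE : p = drop_poly 1 p * 'X.
  rewrite -{1}(poly_take_drop 1 p) expr1 (_ : take_poly 1 p = 0) ?add0r //.
  by apply/polyP => -[|i]; rewrite coef_take_poly coef0.
rewrite pE exprSr dvdp_mul2r ?polyX_eq0 //; apply: IH.
move: dv; rewrite {1}pE comp_polyM comp_polyX mulrCA exprS.
rewrite dvdp_mul2l ?polyX_eq0 // Gauss_dvdpl //.
by rewrite coprimep_sym coprimep_expr // coprimepX /root horner_coef0.
Qed.

(** Expanding the i-th power gives a sum over all i-tuples of exponents; only
exponents at most l can contribute in degree l, which is why p may be replaced
by its truncation. *)
Lemma coef_expr_compositions (R : comNzRingType) (p : {poly R}) (i l : nat) :
  (p ^+ i)`_l =
  \sum_(j : {ffun 'I_i -> 'I_l.+1} | (\sum_(k < i) j k == l)%N)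
    \prod_(k < i) p`_(j k).
Proof.
pose q := take_poly l.+1 p.
have -> : (p ^+ i)`_l = (q ^+ i)`_l.
  apply/eqP; rewrite -subr_eq0 -coefB subrXX.
  have -> : p - q = drop_poly l.+1 p * 'X^(l.+1).
    by rewrite -{1}(poly_take_drop l.+1 p) addrAC subrr add0r.
  by rewrite -mulrA mulrCA mulrC coefMXn ltnSn.
have -> : q ^+ i =
    \sum_(j : {ffun 'I_i -> 'I_l.+1})
      (\prod_(k < i) p`_(j k)) *: 'X^(\sum_(k < i) j k).
  rewrite /q /take_poly poly_def -[i in LHS]card_ord -prodr_const bigA_distr_bigA.
  apply: eq_bigr => j _; rewrite scaler_prod; congr (_ *: _).
  by rewrite -expr_sum.
by rewrite coef_sumMXn.
Qed.

(** * Truncated hyperbolic series *)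

(** The series cosh y - 1 in the variable x = y^2. *)
Definition coshm1 (N : nat) : {poly rat} :=
  \poly_(i < N.+1) ((i != 0%N)%:R / ((2 * i)`!)%:R).

(** The series sinh y / y in the variable x = y^2. *)
Definition sinhc (N : nat) : {poly rat} := \poly_(i < N) ((2 * i + 1)`!)%:R^-1.

(** The coefficients of y / sinh y in powers of cosh y - 1. *)
Definition hcoef (n : nat) : rat :=
  \prod_(i < n) (- i.+1%:R / (2 * i + 3)%:R).

Definition hpoly (N : nat) : {poly rat} := \poly_(i < N) hcoef i.

Lemma fact_neq0 (n : nat) : n`!%:R != 0 :> rat.
Proof. by rewrite pnatr_eq0 -lt0n fact_gt0. Qed.

Lemma coshm1_deriv (N : nat) : (coshm1 N)^`() = 2^-1 *: sinhc N.
Proof.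
apply/polyP => i; rewrite coef_deriv coefZ !coef_poly ltnS.
case: ifP => _; last by rewrite mul0rn mulr0.
have E : (2 * i.+1 = (2 * i + 1).+1)%N by lia.
rewrite E factS -E -mulr_natr !natrM /=.
by field; rewrite fact_neq0 nat1r pnatr_eq0.
Qed.

(** In the variable x, this is d(sinh y)/dy = cosh y, applied to
sinh y = y sinhc(y^2). *)
Lemma cosh_eq_sinhc_deriv (N : nat) :
  'X^N %| 1 + coshm1 N - (sinhc N + 2 *: ('X * (sinhc N)^`())).
Proof.
apply/dvdXnP => i iN.
rewrite coefB !coefD coef1 coefZ coefXM coef_deriv !coef_poly iN leqW //.
case: i iN => [|i] iN /=; first by rewrite mul0r !addr0 subrr.
rewrite iN -[_ *+ i.+1]mulr_natr.
rewrite addn1 factS natrM.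
have := pnatr_eq0 rat (2 * i.+1).+1; rewrite -natr1 natrM => /negbT m0.
by rewrite add0r; field; rewrite fact_neq0 nat1r m0.
Qed.

(** The identity cosh^2 y - sinh^2 y = 1: with C = cosh y, the x-derivative
of the left side is S (C - S - 2x S'), and C = S + 2x S'. *)
Lemma cosh_sqr_sub_sinhc_sqr (N : nat) :
  'X^N %| (1 + coshm1 N) ^+ 2 - 'X * sinhc N ^+ 2 - 1.
Proof.
set p := _ - 1.
have dp : p^`() = sinhc N * (1 + coshm1 N - (sinhc N + 2 *: ('X * (sinhc N)^`()))).
  rewrite /p !(derivB, derivD, derivM, derivX, expr2, coshm1_deriv, derivC).
  rewrite -!mul_polyC.
  have h2 : 2 * (2^-1)%:P = 1 :> {poly rat}.
    by rewrite -[2]/(2%:R) -polyC_natr -polyCM divff.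
  have -> : 2%:P = 2 :> {poly rat} by rewrite -polyC_natr.
  set h := _%:P in h2 *; move: h2.
  set c := coshm1 N; set s := sinhc N; set s' := s^`() => h2.
  transitivity ((2 * h) * s * (1 + c) - s ^+ 2 - 2 * 'X * s * s'); first by ring.
  by rewrite h2; ring.
have /dvdXnP dv : 'X^N %| p^`() by rewrite dp dvdp_mull // cosh_eq_sinhc_deriv.
apply/dvdXnP => -[_|i iN].
  by rewrite /p -horner_coef0 !(hornerE, hornerD) horner_coef0 coef_poly /= mul0r; ring.
have := dv i (ltnW iN); rewrite coef_deriv => /eqP.
by rewrite mulrn_eq0 /= => /eqP.
Qed.

(** The recurrence (2n+3) h_(n+1) + (n+1) h_n = 0, arranged as the coefficient
of w^(n+1) in the differential equation of [hpoly_ode]. *)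
Lemma hcoefS (n : nat) :
  2 * (hcoef n.+1 *+ n.+1) + hcoef n *+ n + hcoef n.+1 + hcoef n = 0.
Proof.
rewrite /hcoef big_ord_recr /= natrD natrM -[_ *+ n.+1]mulr_natr -[_ *+ n]mulr_natr.
have n0 : 2 * n%:R + 3 != 0 :> rat by rewrite -natrM -natrD pnatr_eq0 addn3.
by set P := \prod_(_ < _) _; field.
Qed.

Lemma hpoly_ode (N : nat) :
  'X^N %| 'X * (2 + 'X) * (hpoly N)^`() + (1 + 'X) * hpoly N - 1.
Proof.
have -> : 'X * (2 + 'X) * (hpoly N)^`() + (1 + 'X) * hpoly N - 1 =
  2 *: ('X * (hpoly N)^`()) + 'X * ('X * (hpoly N)^`())
    + hpoly N + 'X * hpoly N - 1.
  by rewrite -mul_polyC -[2 in RHS]/(2%:R) polyC_natr; ring.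
apply/dvdXnP => i iN.
rewrite !(coefB, coefD, coefZ, coefXM, coef_deriv, coef1, coef_poly) iN.
case: i iN => [|[|i]] iN /=.
- by rewrite /hcoef big_ord0; ring.
- by rewrite iN (ltnW iN) subr0 -[RHS](hcoefS 0) mulr0n.
by rewrite iN (ltnW iN) subr0 -[RHS](hcoefS i.+1).
Qed.

(** The composite P = H(w) inherits an equation from that of H, which together
with the two hyperbolic identities becomes 2x (S P)' + S P = 1. In degree n
this says (2n+1) (S P)_n = [n = 0], and 2n+1 never vanishes. *)
Lemma sinhc_hpoly (N : nat) :
  'X^N %| sinhc N * (hpoly N \Po coshm1 N) - 1.
Proof.
set c := coshm1 N; set s := sinhc N.
have Xc : 'X %| c.
  by rewrite -['X]expr1; apply/dvdXnP => -[|//] _; rewrite coef_poly mul0r.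
set P := hpoly N \Po c.
set Q := (hpoly N)^`() \Po c.
have dP : P^`() = Q * (2^-1 *: s) by rewrite deriv_comp coshm1_deriv.
(* w is a multiple of x, so a congruence modulo w^N is one modulo x^N *)
have ode : 'X^N %| c * (2 + c) * Q + (1 + c) * P - 1.
  apply: dvdp_trans (dvdp_exp2r N Xc) _.
  have := dvdp_comp_poly c (hpoly_ode N).
  rewrite comp_Xn_poly comp_polyB !(comp_polyM, comp_polyD, comp_polyX, comp_polyC).
  by rewrite polyC1.
have ode2 : 'X^N %| (s + 2 *: ('X * s^`())) * P + 2 *: ('X * s * P^`()) - 1.
  have -> : (s + 2 *: ('X * s^`())) * P + 2 *: ('X * s * P^`()) - 1 =
   (c * (2 + c) * Q + (1 + c) * P - 1) - ((1 + c) ^+ 2 - 'X * s ^+ 2 - 1) * Q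
    - (1 + c - (s + 2 *: ('X * s^`()))) * P.
    rewrite dP -!scalerAr scalerA divff // scale1r.
    by rewrite -!mul_polyC polyC_natr; ring.
  apply: dvdp_sub; [apply: dvdp_sub ode _ | ]; apply: dvdp_mulr.
    exact: cosh_sqr_sub_sinhc_sqr.
  exact: cosh_eq_sinhc_deriv.
have {ode2} : 'X^N %| s * P + 2 *: ('X * (s * P)^`()) - 1.
  rewrite derivM; congr ('X^N %| _): ode2.
  by rewrite -!mul_polyC; ring.
move/dvdXnP => H; apply/dvdXnP => i /H.
rewrite !(coefB, coefD, coefZ, coefXM, coef_deriv, coef1).
case: i => [|i] /=; first by rewrite mulr0 addr0.
rewrite !subr0 -[_ *+ i.+1]mulr_natr; set y := _`_i.+1.
have -> : y + 2 * (y * i.+1%:R) = (1 + 2 * i.+1%:R) * y by ring.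
by move/eqP; rewrite mulf_eq0 -natrM -(natrD _ 1) pnatr_eq0 => /eqP.
Qed.

(** * The sequence eps as a power series *)

(** The powers of 2 in the definition of eps are absorbed in the coefficients,
so that the series to be substituted is cosh y - 1 rather than its double. *)
Definition epoly (eps : nat -> rat) (N : nat) : {poly rat} :=
  \poly_(i < N) (2 ^+ i * eps i).

Lemma epsilon_termE (eps : nat -> rat) (N l i : nat) : (l <= N)%N ->
  epsilon_term eps l i = 2 ^+ i * eps i * (coshm1 N ^+ i)`_l.
Proof.
move=> lN; rewrite coef_expr_compositions mulr_sumr /epsilon_term.
rewrite big_mkcondr; apply: eq_bigr => j /eqP sj.
case: ifP => [/forallP j0|/negbT].
  congr (_ * _); rewrite -prodfV; apply: eq_bigr => k _.
  by rewrite coef_poly (leq_ltn_trans (leq_ord (j k))) ?ltnS // -lt0n j0 mul1r.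
rewrite negb_forall => /existsP[k]; rewrite lt0n negbK => /eqP jk.
by rewrite (bigD1 k) //= jk coef_poly /= !mul0r mulr0.
Qed.

(** The defining relation of eps, read coefficientwise, is G(w) = S. The range
of the sum in degree l stops at i = l because w^i has order i. *)
Lemma epoly_comp (eps : nat -> rat) (N : nat) : is_epsilon eps ->
  'X^N %| epoly eps N \Po coshm1 N - sinhc N.
Proof.
case=> e0 eS; apply/dvdXnP => l lN.
have c0 : (coshm1 N)`_0 = 0 by rewrite coef_poly mul0r.
have big i : (l < i)%N -> (coshm1 N ^+ i)`_l = 0.
  move=> li.
  have : 'X %| coshm1 N by rewrite -['X]expr1; apply/dvdXnP => -[|//].
  by move/(dvdp_exp2r i)/dvdXnP; apply.
have -> : epoly eps N \Po coshm1 N =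
    \sum_(0 <= i < N) (2 ^+ i * eps i) *: coshm1 N ^+ i.
  rewrite /epoly poly_def raddf_sum /= big_mkord; apply: eq_bigr => i _.
  by rewrite comp_polyZ comp_Xn_poly.
rewrite coefB coef_sum coef_poly lN.
apply/eqP; rewrite subr_eq0; apply/eqP.
rewrite (@big_cat_nat _ _ _ l.+1) //= [X in _ + X]big_nat_cond [X in _ + X]big1 ?addr0; last first.
  by move=> i /andP[/andP[li _] _]; rewrite coefZ big ?mulr0.
rewrite big_nat_recl // coefZ expr0 coef1 e0 !mul1r.
case: l lN big => [|l] lN big.
  by rewrite big_geq.
rewrite eS // big_add1 /= add0r; apply: eq_bigr => i _.
by rewrite coefZ (epsilon_termE _ _ _ _ (ltnW lN)).
Qed.

(** The product G H is 1: after the substitution of w it becomes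
S H(w) = 1, and the substitution can be undone. *)
Lemma epsilon_hcoef_convolution (eps : nat -> rat) (l : nat) : is_epsilon eps ->
  \sum_(i < l.+1) hcoef i * (2 ^+ (l - i) * eps (l - i)%N) = (l == 0%N)%:R.
Proof.
move=> he; pose N := l.+1.
pose u := \poly_(i < N) ((2 * i.+1)`!%:R^-1 : rat).
have cE : coshm1 N = 'X * u.
  apply/polyP => -[|i]; rewrite coefXM coef_poly ?mul0r //=.
  by rewrite coef_poly ltnS mul1r.
have u0 : u`_0 != 0 by rewrite coef_poly invr_neq0 // fact_neq0.
have /dvdXnP/(_ l (ltnSn l)) : 'X^N %| hpoly N * epoly eps N - 1.
  apply: (dvdXn_comp _ _ _ u u0); rewrite -cE.
  rewrite comp_polyB comp_polyM comp_polyC.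
  set P := _ \Po _; set E := _ \Po _.
  have -> : P * E - 1%:P = P * (E - sinhc N) + (sinhc N * P - 1) by ring.
  by rewrite dvdp_add ?sinhc_hpoly // dvdp_mull // epoly_comp.
rewrite coefB coef1 coefM => /eqP; rewrite subr_eq0 => /eqP <-.
apply: eq_bigr => i _; rewrite !coef_poly ltn_ord.
by rewrite ltnS leq_subr.
Qed.

(** * Residues modulo 2 *)

(** [residue2 q b]: the rational q lies in the local ring of the integers at 2,
and b is its image in the residue field with two elements. *)
Definition residue2 (q : rat) (b : bool) : Prop :=
  exists n d : int, [/\ odd `|d|, q = n%:~R / d%:~R & odd `|n| = b].

Lemma odd_intr_neq0 (d : int) : odd `|d| -> d%:~R != 0 :> rat.
Proof. by rewrite intr_eq0; case: eqP => // ->. Qed.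

Lemma residue2M (q r : rat) (b c : bool) :
  residue2 q b -> residue2 r c -> residue2 (q * r) (b && c).
Proof.
move=> [n [d [od -> <-]]] [m [e [oe -> <-]]].
exists (n * m), (d * e); rewrite !abszM !oddM od oe; split=> //.
by rewrite !intrM mulf_div.
Qed.

Lemma residue2D (q r : rat) (b c : bool) :
  residue2 q b -> residue2 r c -> residue2 (q + r) (b (+) c).
Proof.
move=> [n [d [od -> <-]]] [m [e [oe -> <-]]].
exists (n * e + m * d), (d * e); split; first by rewrite abszM oddM od oe.
  by rewrite intrD !intrM addf_div ?odd_intr_neq0.
lia.
Qed.

Lemma residue2_nat (n : nat) : residue2 n%:R (odd n).
Proof. by exists n%:Z, 1; rewrite divr1. Qed.

Lemma residue2N (q : rat) (b : bool) : residue2 q b -> residue2 (- q) b.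
Proof.
move=> [n [d [od -> <-]]]; exists (- n), d; split => //; last by rewrite abszN.
by rewrite intrN mulNr.
Qed.

(** The factors -(i+1)/(2i+3) of h_n have residues 1, 0, 1, 0, ..., so the
second factor makes the product even from n = 2 on. *)
Lemma residue2_hcoef (n : nat) : residue2 (hcoef n) (n <= 1)%N.
Proof.
have step i : residue2 (- i.+1%:R / (2 * i + 3)%:R) (~~ odd i).
  by exists (- i.+1%:Z), (2 * i + 3)%:Z; split=> //; lia.
elim: n => [|[|n] IH]; first by rewrite /hcoef big_ord0; exact: (residue2_nat 1).
  by rewrite /hcoef big_ord1; exact: step 0%N.
rewrite /hcoef big_ord_recr /=.
case: n IH => [|n] IH; first exact: residue2M IH (step 1%N).
exact: residue2M IH (step n.+2).
Qed.

(** The relation G H = 1 in degree l+1 expresses g_(l+1) = 2^(l+1) eps_(l+1)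
through earlier terms: modulo 2 only h_1 g_l survives, and it is odd. *)
Lemma residue2_epsilon (eps : nat -> rat) (l : nat) : is_epsilon eps ->
  residue2 (2 ^+ l * eps l) true.
Proof.
move=> he; elim/ltn_ind: l => -[|l] IH.
  by case: he => -> _; exact: (residue2_nat 1).
have := epsilon_hcoef_convolution eps l.+1 he.
rewrite 2!big_ord_recl /= subn0 {1}/hcoef big_ord0 mul1r => /eqP.
rewrite addr_eq0 => /eqP ->; apply: residue2N.
rewrite -[true]/(true (+) false); apply: residue2D.
  apply: (residue2M _ _ true true) (residue2_hcoef 1) _.
  by apply: IH; rewrite subSS ltnS leq_subr.
apply: (big_ind (fun q => residue2 q false)) => [|q r hq hr|i _].
- exact: (residue2_nat 0).
- exact: (residue2D _ _ false false).
rewrite -[false]/(false && true); apply: residue2M.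
  exact: (residue2_hcoef i.+2).
by apply: IH; rewrite /= /bump /=; lia.
Qed.

Theorem theorem4p4 (eps : nat -> rat) (heps : is_epsilon eps) (l : nat) :
  padic_val 2 (eps l) = - (l%:Z).
Proof.
have [n [d [od E on]]] := residue2_epsilon eps l heps.
have cop (x : int) : odd `|x| -> coprimez x 2.
  by move=> ox; rewrite coprimezE coprimen2.
have -> : eps l = (2%:R ^+ 0 * n%:~R) / (2%:R ^+ l * d%:~R).
  have t0 : 2 ^+ l != 0 :> rat by rewrite expf_neq0.
  by rewrite mul1r invfM mulrCA -E mulKf.
by rewrite padic_valE ?cop // sub0r.
Qed.
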